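(* Let $A$ be a complex antidiagonal matrix of size $n$, with center element $c$ if $n$ is odd. Let $\hat{\mathcal T}$ be the set of transpose pairs $\tau=\{\tau_1,\tau_2\}$ on the antidiagonal of $A$. Then for any choice of real numbers $t_\tau$ (one for each $\tau$), $A$ is unitarily similar to $\mathfrak S$, where $$\mathfrak S=\bigoplus_{\tau\in\hat{\mathcal T}}\begin{pmatrix}-\sqrt{\tau_1\tau_2}&(|\tau_2|-|\tau_1|)e^{\imath t_\tau}\\0&\sqrt{\tau_1\tau_2}\end{pmatrix}\quad(n\text{ even}),$$ $$\mathfrak S=\bigoplus_{\tau\in\hat{\mathcal T}\setminus\{c,c\}}\begin{pmatrix}-\sqrt{\tau_1\tau_2}&(|\tau_2|-|\tau_1|)e^{\imath t_\tau}\\0&\sqrt{\tau_1\tau_2}\end{pmatrix}\oplus c\,(1)\quad(n\text{ odd}),$$ where $(1)$ is the identity matrix of size $1$ and $\hat{\mathcal T}\setminus\{c,c\}$ denotes the transpose pairs other than the one consisting of the center element.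
   Context: An antidiagonal matrix has nonzero entries only at positions $(i,n+1-i)$. A transpose pair is a pair of indexed entries that are reflections of each other across the main diagonal (the center element of an odd-size matrix is paired with itself). Unitarily similar means $A=U\mathfrak SU^{-1}$ with $U$ unitary. $\sqrt{\tau_1\tau_2}$ is a complex square root of $\tau_1\tau_2$, and $\imath=\sqrt{-1}$. *)

(* Defs.v *)
From mathcomp Require Import all_boot all_order all_algebra.
From mathcomp Require Import complex.
From mathcomp Require Import reals trigo.

Set Implicit Arguments.
Unset Strict Implicit.
Unset Printing Implicit Defensive.

Import Order.TTheory GRing.Theory Num.Theory.

Local Open Scope ring_scope.
Local Open Scope complex_scope.

(* [rev_ord i] is [n - i.+1], which is the usual n+1-i for 1-based indices. *)
Definition antidiagonal (K : nmodType) (n : nat) (A : 'M[K]_n) : Prop :=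
  forall i j : 'I_n, j != rev_ord i -> A i j = 0.

(* The entries making up transpose pairs are indexed entries, so they are
   represented by their positions: entries with equal values stay distinct. *)
Definition entry (K : Type) (n : nat) (A : 'M[K]_n) (x : 'I_n * 'I_n) : K :=
  A x.1 x.2.

(* A singleton exactly when [x] lies on the main diagonal. *)
Definition transpose_pair (n : nat) (x : 'I_n * 'I_n) : {set 'I_n * 'I_n} :=
  [set x; (x.2, x.1)].

Definition antidiag_pairs (n : nat) : {set {set 'I_n * 'I_n}} :=
  [set transpose_pair (i, rev_ord i) | i : 'I_n].

Lemma half_lt_odd (n : nat) : odd n -> (n./2 < n)%N.
Proof. by move=> n_odd; rewrite ltn_half_double -addnn -ltn_subLR ?subnn ?odd_gt0. Qed.

Definition center (n : nat) (n_odd : odd n) : 'I_n * 'I_n :=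
  (Ordinal (half_lt_odd n_odd), Ordinal (half_lt_odd n_odd)).

Definition expi (R : realType) (t : R) : R[i] := cos t +i* sin t.

(* The sizes of direct sums are only propositionally equal to the expected
   ones, so equality of the sizes is part of the relation. *)
Definition unitarily_similar (C : numClosedFieldType) (n m : nat)
    (A : 'M[C]_n) (S : 'M[C]_m) : Prop :=
  exists (e : m = n) (U : 'M[C]_n),
    U \is unitarymx /\ A = U *m castmx (e, e) S *m invmx U.

(* [s] is the chosen square root of [t1 * t2]. *)
Definition schur_block (R : realType) (t1 t2 s : R[i]) (t : R) : 'M[R[i]]_2 :=
  @block_mx _ 1 1 1 1
    (- s)%:M ((`|t2| - `|t1|) * expi t)%:M
    0        s%:M.

Definition direct_sum (K : nmodType) (I : Type) (d : nat) (r : seq I)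
    (B : I -> 'M[K]_d) : 'M[K]_(\sum_(k < size r) d) :=
  \mxdiag_(k < size r) B (tnth (in_tuple r) k).

(* Main.v *)
(** Listing the coordinates of each transpose pair {(i,j), (j,i)} consecutively
    as i, j makes A block diagonal by a permutation similarity, with blocks
    [[0, a], [b, 0]], plus the center when n is odd. If s^2 = ab, such a block
    has a unit eigenvector (x, y) for -s; in the orthonormal basis formed by
    (x, y) and u (- y^*, x^* ), |u| = 1, it becomes upper triangular with diagonal -s, s
    and corner u (a x^*^2 - b y^*^2), whose modulus is | |b| - |a| |. The phase u
    is free, so the corner can be given any prescribed argument. *)

Require Import Defs.
From mathcomp Require Import all_boot all_order all_algebra fingroup perm.
From mathcomp Require Import complex ring.
From mathcomp Require Import reals trigo.

Set Implicit Arguments.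
Unset Strict Implicit.
Unset Printing Implicit Defensive.

Import Order.TTheory GRing.Theory Num.Theory.

Local Open Scope ring_scope.

Local Notation mx2 a b c d :=
  (@block_mx _ 1 1 1 1 a%:M b%:M c%:M d%:M).

(** * Unitary triangularization of a 2 x 2 antidiagonal block *)

Lemma antidiagonal2_eigenvector (C : numClosedFieldType) (a b s : C) :
  s ^+ 2 = a * b ->
  exists x y : C,
    [/\ x * x^* + y * y^* = 1, a * y = - (s * x) & b * x = - (s * y)].
Proof.
move=> hs.
have [x [y [nz hx hy]]] : exists x y : C,
    [/\ (x != 0) || (y != 0), a * y = - (s * x) & b * x = - (s * y)].
  (* The vector [(a, - s)] is an eigenvector for [- s] unless it vanishes, which happens exactly
     when [a = 0]; then [s = 0] and [(0, 1)] lies in the kernel. *)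
  have [a0|an0] := eqVneq a 0.
    exists 0, 1; have /eqP : s ^+ 2 = 0 by rewrite hs a0 mul0r.
    by rewrite expf_eq0 /= => /eqP ->; rewrite a0 oner_eq0 orbT; split=> //; ring.
  exists a, (- s); rewrite an0; split=> //; first by ring.
  by rewrite mulrN opprK -expr2 hs mulrC.
pose N := sqrtC (x * x^* + y * y^*).
have N2 : N * N = x * x^* + y * y^* by rewrite -expr2 sqrtCK.
have Nge0 : 0 <= N by rewrite sqrtC_ge0 addr_ge0 ?mul_conjC_ge0.
have Nn0 : N != 0.
  rewrite sqrtC_eq0 paddr_eq0 ?mul_conjC_ge0 // !mul_conjC_eq0.
  by rewrite negb_and.
have NC : N^* = N by rewrite conj_Creal ?ger0_real.
exists (x / N), (y / N).
rewrite !rmorphM !fmorphV /= NC; split.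
- have -> : x / N * (x^* / N) + y / N * (y^* / N)
     = (x * x^* + y * y^*) / (N * N) by field.
  by rewrite -N2 divff ?mulf_neq0.
- by rewrite mulrA hx mulrA mulNr.
- by rewrite mulrA hy mulrA mulNr.
Qed.

(** Supplies the free phase of the second basis vector. The quotient [d / z] works unless [z = 0];
    then [d = 0] too and any phase will do. *)
Lemma norm1_scaling (C : numClosedFieldType) (z d : C) :
  `|z| = `|d| -> exists2 u : C, u * u^* = 1 & u * z = d.
Proof.
move=> zd; have [z0|zn0] := eqVneq z 0.
  exists 1; first by rewrite rmorph1 mulr1.
  by rewrite mul1r z0; apply/esym/eqP; rewrite -normr_eq0 -zd z0 normr0.
exists (d / z); last by rewrite divfK.
by rewrite -normCK normrM normfV zd divff ?expr1n // -zd normr_eq0.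
Qed.

(** The intertwining form lets blocks be assembled into a direct sum before any inverse is taken. *)
Lemma antidiagonal2_unitary_schur (C : numClosedFieldType) (a b s w : C) :
  s ^+ 2 = a * b -> `|w| = 1 ->
  exists2 V : 'M[C]_(1 + 1), V \is unitarymx &
    mx2 0 a b 0 *m V = V *m mx2 (- s) ((`|b| - `|a|) * w) 0 s.
Proof.
move=> hs hw; have [x [y [xy1 hx hy]]] := antidiagonal2_eigenvector hs.
have [u u1 hu] : exists2 u : C, u * u^* = 1 &
    u * (a * x^* ^+ 2 - b * y^* ^+ 2) = (`|b| - `|a|) * w.
  (* Both moduli are compared through their squares, which are polynomial in the entries and their
     conjugates once [|b| |a|] is replaced by [s * s^*]. *)
  apply: norm1_scaling; apply/eqP; rewrite -(@eqrXn2 _ 2) //.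
  rewrite (normrM _ w) hw mulr1 normCK real_normK ?rpredB ?normr_real //.
  have hxC : a^* * y^* = - (s^* * x^*) by rewrite -!rmorphM -rmorphN hx.
  have hyC : b^* * x^* = - (s^* * y^*) by rewrite -!rmorphM -rmorphN hy.
  have ab : `|b| * `|a| = s * s^*.
    by rewrite mulrC -normrM -hs normrX normCK.
  rewrite sqrrB ab !normCK !(rmorphB, rmorphM, rmorphXn) /= !conjCK.
  apply/eqP; move: xy1 hx hy hxC hyC.
  (* With the conjugates as independent variables, a polynomial identity remains, modulo the unit
     norm, the eigenvector equations and their conjugates. *)
  move: x^* y^* a^* b^* s^* => x' y' a' b' s' xy1 hx hy hxC hyC.
  have E1 : (a * y) * (b' * x') * (x' * y) = s * s' * (x * x') * (y * y').
    by rewrite hx hyC; ring.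
  have E2 : (b * x) * (a' * y') * (x * y') = s * s' * (x * x') * (y * y').
    by rewrite hy hxC; ring.
  have E3 : (a * y) * (a' * y') = s * s' * (x * x') by rewrite hx hxC; ring.
  have E4 : (b * x) * (b' * x') = s * s' * (y * y') by rewrite hy hyC; ring.
  have -> : (a * x' ^+ 2 - b * y' ^+ 2) * (a' * x ^+ 2 - b' * y ^+ 2)
    = a * a' * (x * x') ^+ 2 + b * b' * (y * y') ^+ 2
      - (a * y) * (b' * x') * (x' * y) - (b * x) * (a' * y') * (x * y').
    by ring.
  (* The unit norm reduces the leading terms to [a * a'] and [b * b']; the corrections contain only
     products that [E3] and [E4] express through [s * s']. *)
  have -> : a * a' * (x * x') ^+ 2 = a * a' * (x * x' + y * y') ^+ 2
      - (a * y) * (a' * y') * (2 * (x * x') + y * y') by ring.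
  have -> : b * b' * (y * y') ^+ 2 = b * b' * (x * x' + y * y') ^+ 2
      - (b * x) * (b' * x') * (x * x' + 2 * (y * y')) by ring.
  (* The terms in [s * s'] add up to [- 2 s s' (x x' + y y')^2], that is, [- 2 s s']. *)
  rewrite E1 E2 E3 E4.
  have -> : y * y' = 1 - x * x' by rewrite -xy1; ring.
  by ring.
exists (mx2 x (- (u * y^*)) y (u * x^*)).
  apply/unitarymxP.
  rewrite tr_block_mx map_block_mx !tr_scalar_mx !map_scalar_mx mulmx_block.
  rewrite -!scalar_mxM -!raddfD /= !(rmorphN, rmorphM) /= !conjCK.
  have -> : x * x^* + - (u * y^*) * - (u^* * y) = 1 by rewrite -xy1; ring: u1.
  have -> : y * y^* + u * x^* * (u^* * x) = 1 by rewrite -xy1; ring: u1.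
  have -> : x * y^* + - (u * y^*) * (u^* * x) = 0 by ring: u1.
  have -> : y * x^* + u * x^* * - (u^* * y) = 0 by ring: u1.
  by rewrite [RHS](scalar_mx_block 1 1) !raddf0.
(* For the second column, the difference of the two sides is an explicit combination of these three
   vanishing expressions. *)
have e0 : x * x^* + y * y^* - 1 = 0 by rewrite xy1 subrr.
have e1 : a * y + s * x = 0 by rewrite hx addNr.
have e2 : b * x + s * y = 0 by rewrite hy addNr.
rewrite !mulmx_block -!scalar_mxM -!raddfD /= -hu.
congr (block_mx _%:M _%:M _%:M _%:M).
- by rewrite hx; ring.
- apply/eqP; rewrite eq_sym -subr_eq0.
  transitivity (u * ((a * x^* + s * y^*) * (x * x^* + y * y^* - 1)
      - x^* * y^* * (a * y + s * x) - y^* ^+ 2 * (b * x + s * y)) == 0).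
    by congr (_ == 0); ring.
  by rewrite e0 e1 e2 !mulr0 !subr0 mulr0 eqxx.
- by rewrite hy; ring.
- apply/eqP; rewrite eq_sym -subr_eq0.
  transitivity (u * (x^* ^+ 2 * (a * y + s * x) + x^* * y^* * (b * x + s * y)
      - (b * y^* + s * x^*) * (x * x^* + y * y^* - 1)) == 0).
    by congr (_ == 0); ring.
  by rewrite e0 e1 e2 !mulr0 !subr0 addr0 mulr0 eqxx.
Qed.

(** * Reordering coordinates as a unitary similarity *)

Lemma unitarily_similar_reindex (C : numClosedFieldType) (n m : nat)
    (A : 'M[C]_n) (M S D : 'M[C]_m) (f : 'I_m -> 'I_n) :
  injective f -> (forall i, exists l, f l = i) ->
  (forall l l', A (f l) (f l') = M l l') ->
  D \is unitarymx -> M *m D = D *m S -> unitarily_similar A S.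
Proof.
move=> f_inj f_surj AM D_unitary MD.
(* The equality of sizes comes from the bijectivity of [f]. *)
have e : m = n.
  have [g fg] := fin_all_exists f_surj.
  have /bij_eq_card : bijective f by exists g => // l; apply: f_inj; rewrite fg.
  by rewrite !card_ord.
(* Identifying the sizes makes [f] an injective self-map, hence a permutation, and makes the cast
   trivial. *)
case: n / e A f f_inj {f_surj} AM => A f f_inj AM.
pose Q : 'M[C]_m := perm_mx (perm f_inj).
pose Qi : 'M[C]_m := perm_mx (perm f_inj)^-1.
have QiQ : Qi *m Q = 1%:M by rewrite -perm_mxM mulVg perm_mx1.
have AQ : A = Qi *m M *m Q.
  suff -> : M = Q *m A *m Qi.
    by rewrite !mulmxA QiQ mul1mx -mulmxA QiQ mulmx1.
  rewrite -row_permE -col_permE; apply/matrixP => l l'.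
  by rewrite !mxE !permE AM.
have Qi_unitary : Qi \is unitarymx.
  by apply/unitarymxP; rewrite tr_perm_mx map_perm_mx -perm_mxM mulgV perm_mx1.
have U_unitary := mul_unitarymx Qi_unitary D_unitary.
exists (erefl m), (Qi *m D); split=> //; rewrite castmx_id.
suff <- : A *m (Qi *m D) = Qi *m D *m S by rewrite mulmxK ?unitarymx_unit.
have QQi : Q *m Qi = 1%:M by rewrite -perm_mxM mulgV perm_mx1.
by rewrite AQ !mulmxA -(mulmxA _ Q) QQi mulmx1 -mulmxA MD mulmxA.
Qed.

(** * Direct sums of blocks and their unitarity *)

Lemma mxdiag_constE (K : nmodType) (k d : nat) (B : 'I_k -> 'M[K]_d) l l' :
  (\mxdiag_(i < k) B i) l l' =
  if tagnat.sig1 l == tagnat.sig1 l'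
  then B (tagnat.sig1 l) (tagnat.sig2 l) (tagnat.sig2 l') else 0.
Proof. by rewrite mxE; case: eqP => _; rewrite ?conform_mx_id ?mxE. Qed.

Lemma map_mxdiag_const (K L : nmodType) (g : {additive K -> L}) (k d : nat)
    (B : 'I_k -> 'M[K]_d) :
  map_mx g (\mxdiag_(i < k) B i) = \mxdiag_(i < k) map_mx g (B i).
Proof.
apply/matrixP => l l'; rewrite [LHS]mxE !mxdiag_constE.
by case: ifP => _; rewrite ?mxE ?raddf0.
Qed.

Lemma mul_mxdiag_const (K : pzSemiRingType) (k d : nat) (B B' : 'I_k -> 'M[K]_d) :
  \mxdiag_(i < k) B i *m \mxdiag_(i < k) B' i = \mxdiag_(i < k) (B i *m B' i).
Proof.
rewrite {2}/mxdiag mul_mxdiag_mxblock; apply/eq_mxblock => i j.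
by case: eqP => [->|_]; rewrite ?conform_mx_id ?mulmx0.
Qed.

Lemma mxdiag_unitary (C : numClosedFieldType) (k d : nat) (V : 'I_k -> 'M[C]_d) :
  (forall i, V i \is unitarymx) -> \mxdiag_(i < k) V i \is unitarymx.
Proof.
move=> V_unitary; apply/unitarymxP.
rewrite tr_mxdiag map_mxdiag_const mul_mxdiag_const -mxdiagZ.
by apply: eq_mxdiag => i; apply/unitarymxP.
Qed.

Lemma block_mx_unitary (C : numClosedFieldType) (m1 m2 : nat)
    (V : 'M[C]_m1) (W : 'M[C]_m2) :
  V \is unitarymx -> W \is unitarymx -> block_mx V 0 0 W \is unitarymx.
Proof.
move=> /unitarymxP hV /unitarymxP hW; apply/unitarymxP.
rewrite tr_block_mx map_block_mx !trmx0 !map_mx0 mulmx_block.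
by rewrite !mulmx0 !mul0mx !addr0 !add0r hV hW -scalar_mx_block.
Qed.

Lemma normr_expi (R : realType) (t : R) : `|expi t| = 1.
Proof. by rewrite normc_def /= cos2Dsin2 sqrtr1. Qed.

(** * Transpose pairs on the antidiagonal and their coordinates *)

Lemma mem_antidiag_pairs (n : nat) (tau : {set 'I_n * 'I_n}) x :
  tau \in antidiag_pairs n -> x \in tau ->
  x.2 = rev_ord x.1 /\ tau = transpose_pair x.
Proof.
move=> /imsetP[i _ ->]; rewrite !inE => /orP[]/eqP-> //=.
by rewrite rev_ordK /transpose_pair /= setUC.
Qed.

(** Since [tau] is the transpose pair of [x], the label [y] is [x] or its reflection. If [y = x],
    then [tau] is a singleton containing the reflection of [x], so the two coincide. *)
Lemma antidiag_pair_labels (n : nat) (tau : {set 'I_n * 'I_n}) x y :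
  tau \in antidiag_pairs n -> tau = [set x; y] ->
  [/\ x.2 = rev_ord x.1, y = (x.2, x.1) & tau = transpose_pair x].
Proof.
move=> tau_anti tauE.
have [x2 tx] : x.2 = rev_ord x.1 /\ tau = transpose_pair x.
  by apply: mem_antidiag_pairs => //; rewrite tauE set21.
split=> //; have : y \in transpose_pair x by rewrite -tx tauE set22.
rewrite !inE => /orP[]/eqP // yx.
have : (x.2, x.1) \in tau by rewrite tx set22.
by rewrite tauE yx setUid inE => /eqP.
Qed.

Lemma transpose_pair_inj (n : nat) (i j : 'I_n) :
  transpose_pair (i, rev_ord i) = transpose_pair (j, rev_ord j) ->
  (i == j) || (i == rev_ord j).
Proof.
move=> ij; have : (i, rev_ord i) \in transpose_pair (j, rev_ord j).
  by rewrite -ij set21.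
by rewrite !inE !xpair_eqE => /orP[]/andP[-> _]; rewrite ?orbT.
Qed.

(** Common core of both parities. The map [f] is only an injection with known image, so that the
    center can be adjoined when [n] is odd. *)
Lemma antidiagonal_pairs_unitary_schur (R : realType) (n : nat)
    (A : 'M[R[i]]_n) (p q : {set 'I_n * 'I_n} -> 'I_n * 'I_n)
    (s : {set 'I_n * 'I_n} -> R[i]) (t : {set 'I_n * 'I_n} -> R)
    (r : seq {set 'I_n * 'I_n}) :
  let B tau :=
    schur_block (entry A (p tau)) (entry A (q tau)) (s tau) (t tau) in
  antidiagonal A -> uniq r -> {subset r <= antidiag_pairs n} ->
  {in r, forall tau, tau = [set p tau; q tau]} ->
  {in r, forall tau, s tau ^+ 2 = entry A (p tau) * entry A (q tau)} ->
  (forall i, transpose_pair (i, rev_ord i) \in r -> i != rev_ord i) ->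
  exists (f : 'I_(\sum_(k < size r) 2) -> 'I_n) (M D : 'M[R[i]]__),
    [/\ injective f,
        forall i, transpose_pair (i, rev_ord i) \in r <-> exists l, f l = i,
        forall l l', A (f l) (f l') = M l l',
        D \is unitarymx & M *m D = D *m direct_sum r B].
Proof.
move=> B hA r_uniq r_anti hpq hs r_off.
pose tau k := tnth (in_tuple r) k.
have tau_r k : tau k \in r by exact: mem_tnth.
have tau_inj : injective tau by apply/tuple_uniqP.
pose i0 k := (p (tau k)).1.
have labels k : [/\ p (tau k) = (i0 k, rev_ord (i0 k)),
    q (tau k) = (rev_ord (i0 k), i0 k) &
    tau k = transpose_pair (i0 k, rev_ord (i0 k))].
  have [p2 q12 tp] := antidiag_pair_labels (r_anti _ (tau_r k)) (hpq _ (tau_r k)).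
  have pE : p (tau k) = (i0 k, rev_ord (i0 k)) by rewrite /i0 -p2; case: (p _).
  by split; [exact: pE | rewrite q12 p2 | rewrite -pE].
have i0_off k : i0 k != rev_ord (i0 k).
  by apply: r_off; have [_ _ <-] := labels k.
(* The row of [p (tau k)] comes first, which puts the first entry of the pair in the upper right
   corner of its block. *)
pose g k (j : 'I_2) := if j == 0 then i0 k else rev_ord (i0 k).
(* Each coordinate recovers its pair; this separates the blocks in the injectivity, image and
   vanishing arguments below. *)
have g_tau k j : transpose_pair (g k j, rev_ord (g k j)) = tau k.
  rewrite /g; have [_ _ ->] := labels k; case: ifP => // _.
  by rewrite rev_ordK /transpose_pair setUC.
have g_inj2 k : injective (g k).
  move=> j j'; rewrite /g.
  have neq0 (x : 'I_2) : x != 0 -> x = 1 by case: x => -[|[|]] //= ? _; exact: val_inj.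
  case: eqVneq => [->|/neq0 ->]; case: eqVneq => [->|/neq0 ->] // /eqP.
    by rewrite (negPf (i0_off k)).
  by rewrite eq_sym (negPf (i0_off k)).
pose f (l : 'I_(\sum_(k < size r) 2)) := g (tagnat.sig1 l) (tagnat.sig2 l).
have f_tau l : transpose_pair (f l, rev_ord (f l)) = tau (tagnat.sig1 l).
  exact: g_tau.
pose M0 k := mx2 0 (entry A (p (tau k))) (entry A (q (tau k))) 0.
have /fin_all_exists2[V V_unitary MV] : forall k, exists2 V : 'M[R[i]]_2,
    V \is unitarymx & M0 k *m V = V *m B (tau k).
  move=> k; have [V Vu MV] :=
    antidiagonal2_unitary_schur (hs _ (tau_r k)) (normr_expi (t (tau k))).
  by exists V => //; rewrite /M0 MV /B /schur_block raddf0.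
exists f, (\mxdiag_(k < size r) M0 k), (\mxdiag_(k < size r) V k); split.
- move=> l l' ff.
  have /tau_inj : tau (tagnat.sig1 l) = tau (tagnat.sig1 l') by rewrite -!f_tau ff.
  move=> kk; rewrite -[LHS]tagnat.sig2K -[RHS]tagnat.sig2K; move: ff kk; rewrite /f.
  move: (tagnat.sig1 l) (tagnat.sig1 l') (tagnat.sig2 l) (tagnat.sig2 l').
  move=> k k' /= j j' gg kk; case: k' / kk j' gg => j' /g_inj2 -> //.
- move=> i; split=> [ir|[l <-]]; last by rewrite f_tau.
  have /tnthP[k /esym ik] : transpose_pair (i, rev_ord i) \in in_tuple r by [].
  have [j <-] : exists j, g k j = i; last first.
    exists (@tagnat.Rank _ (fun=> 2%N) k j).
    congr (g _ _); first exact: tagnat.Rank1K.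
    by apply: val_inj; rewrite tagnat.Rank2K.
  have [_ _ tauE] := labels k; move: ik; rewrite -/(tau k) tauE.
  move=> /esym/transpose_pair_inj /orP[]/eqP->.
    by exists 0.
  by exists 1.
- move=> l l'; rewrite mxdiag_constE /f.
  move: (tagnat.sig1 l) (tagnat.sig1 l') (tagnat.sig2 l) (tagnat.sig2 l').
  move=> k k' /= j j'; case: eqVneq => [<-|kk'].
    have [pE qE _] := labels k; rewrite /M0 /entry pE qE /=.
    have gl : g k (@lshift 1 1 0) = i0 k by [].
    have gr : g k (@rshift 1 1 0) = rev_ord (i0 k) by [].
    have A0 i : i \in [:: i0 k; rev_ord (i0 k)] -> A i i = 0.
      rewrite !inE => /orP[]/eqP->; apply: hA; rewrite ?rev_ordK //.
      by rewrite eq_sym.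
    case: (@split_ordP 1 1 j) => x ->; case: (@split_ordP 1 1 j') => y ->;
      rewrite ?(@block_mxEul _ 1 1 1 1, @block_mxEur _ 1 1 1 1,
        @block_mxEdl _ 1 1 1 1, @block_mxEdr _ 1 1 1 1) !ord1 mxE.
    - by rewrite mul0rn gl A0 ?inE ?eqxx.
    - by rewrite eqxx mulr1n gl gr.
    - by rewrite eqxx mulr1n gl gr.
    - by rewrite mul0rn gr A0 ?inE ?eqxx ?orbT.
  (* A coordinate and its reversal belong to the same pair, so a position joining two different
     blocks is off the antidiagonal. *)
  apply: hA; apply: contraNneq kk' => gE; apply/eqP/tau_inj.
  by rewrite -(g_tau k j) -(g_tau k' j') gE rev_ordK /transpose_pair setUC.
- exact: mxdiag_unitary.
- by rewrite /direct_sum !mul_mxdiag_const; apply: eq_mxdiag.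
Qed.

(** Excludes coordinates fixed by reversal when [n] is even and pins down the only one when [n] is
    odd. *)
Lemma rev_ord_fixed (n : nat) (i : 'I_n) : i = rev_ord i -> n = i.*2.+1.
Proof.
move=> /(congr1 val) /= ii; rewrite -{1}(subnK (ltn_ord i)) -{1}ii.
by rewrite addnS addnn.
Qed.

(* [r] lists the transpose pairs in an arbitrary order; [p], [q] pick an
   arbitrary labelling tau = {tau_1, tau_2}; [s] picks square roots. *)
Theorem corollary6p4 (R : realType) (n : nat) (A : 'M[R[i]]_n)
    (hA : antidiagonal A)
    (p q : {set 'I_n * 'I_n} -> 'I_n * 'I_n)
    (hpq : forall tau, tau \in antidiag_pairs n -> tau = [set p tau; q tau])
    (s : {set 'I_n * 'I_n} -> R[i])
    (hs : forall tau, tau \in antidiag_pairs n ->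
       s tau ^+ 2 = entry A (p tau) * entry A (q tau))
    (t : {set 'I_n * 'I_n} -> R) :
  let B tau :=
    schur_block (entry A (p tau)) (entry A (q tau)) (s tau) (t tau) in
  (~~ odd n ->
     forall r : seq {set 'I_n * 'I_n},
       uniq r -> r =i antidiag_pairs n ->
       unitarily_similar A (direct_sum r B))
  /\
  (forall n_odd : odd n,
     let c := center n_odd in
     forall r : seq {set 'I_n * 'I_n},
       uniq r -> r =i antidiag_pairs n :\ transpose_pair c ->
       unitarily_similar A
         (block_mx (direct_sum r B) 0 0 (entry A c *: (1%:M : 'M_1)))).
Proof.
move=> B.
have mem_pairs (i : 'I_n) : transpose_pair (i, rev_ord i) \in antidiag_pairs n.
  by apply/imsetP; exists i.
split=> [n_even|n_odd c] r r_uniq rE.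
  have r_anti : {subset r <= antidiag_pairs n} by move=> tau; rewrite rE.
  have r_off (i : 'I_n) : transpose_pair (i, rev_ord i) \in r -> i != rev_ord i.
    move=> _; apply: contraNneq n_even => /rev_ord_fixed ->.
    by rewrite /= odd_double.
  have [f [M [D [f_inj f_im fM D_unitary MD]]]] := antidiagonal_pairs_unitary_schur t
    hA r_uniq r_anti (sub_in1 r_anti hpq) (sub_in1 r_anti hs) r_off.
  apply: (unitarily_similar_reindex f_inj _ fM D_unitary MD) => i.
  by apply/f_im; rewrite rE.
(* Reversal fixes [h] and no other coordinate, so the pairs in [r] cover exactly the coordinates
   other than [h]. *)
pose h : 'I_n := c.1.
have hh : rev_ord h = h.
  apply: val_inj => /=; have := odd_double_half n; rewrite n_odd => {1}<-.
  by rewrite add1n subSS -addnn addnK.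
have h_fix (i : 'I_n) : i = rev_ord i -> i = h.
  move=> /rev_ord_fixed/(congr1 half) nE; apply: val_inj => /=.
  by rewrite nE /= uphalf_double.
have r_anti : {subset r <= antidiag_pairs n}.
  by move=> tau; rewrite rE !inE => /andP[].
have r_pair i : (transpose_pair (i, rev_ord i) \in r) = (i != h).
  rewrite rE in_setD1 mem_pairs andbT; congr negb.
  rewrite -[c]/(h, h) -{2}hh; apply/eqP/eqP => [/transpose_pair_inj|-> //].
  by rewrite hh orbb => /eqP.
have r_off (i : 'I_n) : transpose_pair (i, rev_ord i) \in r -> i != rev_ord i.
  by rewrite r_pair; apply: contraNneq => /h_fix ->.
have [f [M [D [f_inj f_im fM D_unitary MD]]]] := antidiagonal_pairs_unitary_schur t
  hA r_uniq r_anti (sub_in1 r_anti hpq) (sub_in1 r_anti hs) r_off.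
have f_neq l : f l != h by rewrite -r_pair; apply/f_im; exists l.
(* The center is listed last, as in the direct sum, and the unitary matrix is extended by 1
   there. *)
pose f' (l : 'I_(\sum_(k < size r) 2 + 1)) := if split l is inl k then f k else h.
apply: (@unitarily_similar_reindex _ _ _ _ (block_mx M 0 0 (entry A c *: 1%:M)) _
  (block_mx D 0 0 1%:M) f').
- move=> l l'; rewrite /f'; case: split_ordP => k ->; case: split_ordP => k' ->.
  + by move/f_inj->.
  + by move/eqP; rewrite (negPf (f_neq k)).
  + by move/esym/eqP; rewrite (negPf (f_neq k')).
  + by rewrite !ord1.
- move=> i; have [->|ih] := eqVneq i h.
    by exists (rshift _ 0); rewrite /f' (unsplitK (inr _)).
  move: ih; rewrite -r_pair => /f_im[l <-].
  by exists (lshift _ l); rewrite /f' (unsplitK (inl _)).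
(* The antidiagonal partner of [h] is [h] itself, so the rest of its row and column vanishes. *)
- move=> l l'; rewrite /f'; case: split_ordP => k ->; case: split_ordP => k' ->.
  + by rewrite block_mxEul fM.
  + rewrite block_mxEur mxE; apply: hA; rewrite eq_sym -[h]hh.
    by rewrite (inj_eq rev_ord_inj).
  + by rewrite block_mxEdl mxE; apply: hA; rewrite hh.
  + by rewrite block_mxEdr !ord1 !mxE mulr1.
- by apply: block_mx_unitary => //; apply/unitarymxP; rewrite trmx1 map_mx1 mulmx1.
- by rewrite !mulmx_block !mulmx0 !mul0mx !addr0 !add0r MD mul1mx mulmx1.
Qed.
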